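(* Let $X$ be a compact smooth $n$-dimensional manifold and $P$ an $h$-differential operator on $X$ of the form $\sum_{|\alpha|\le m}a_\alpha(x;h)(hD_x)^\alpha$ in local coordinates, with coefficients uniformly bounded in $C^\infty$, $a_\alpha=a_\alpha^0+\mathcal{O}(h)$ in $C^\infty$, $a_\alpha$ independent of $h$ for $|\alpha|=m$, and classically elliptic: $|\sum_{|\alpha|=m}a_\alpha(x)\xi^\alpha|\ge\frac1C|\xi|^m$. Let $p(x,\xi)=\sum_{|\alpha|\le m}a^0_\alpha(x)\xi^\alpha$, fix $z\in\mathbb{C}$, let $s=|p-z|^2$, and for $0<\alpha\ll 1$ let $\Lambda=\left(\frac{\alpha+s}{1+s}\right)^{1/2}$. Then for every choice of local coordinates $x$ on $X$, with $(x,\xi)$ the corresponding canonical coordinates on $T^*X$, for all $\ell\in\mathbb{R}$ and $\widetilde\alpha,\beta\in\mathbb{N}^n$ we have, uniformly in $\xi$ and in $\alpha$ and locally uniformly in $x$, $$\partial_x^{\widetilde\alpha}\partial_\xi^\beta\Big(1+\frac s\alpha\Big)^\ell=\mathcal{O}(1)\Big(1+\frac s\alpha\Big)^\ell\Lambda^{-|\widetilde\alpha|-|\beta|}\langle\xi\rangle^{-|\beta|}.$$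
   Context: $\langle\xi\rangle=(1+|\xi|^2)^{1/2}$. Note $\sqrt\alpha\le\Lambda\le1$. *)

(* Defs.v *)
From HB Require Import structures.
From mathcomp Require Import all_boot all_order all_algebra.
From mathcomp Require Import all_classical all_reals all_analysis.
Set Implicit Arguments. Unset Strict Implicit. Unset Printing Implicit Defensive.
Import Order.TTheory GRing.Theory Num.Theory.
Import numFieldNormedType.Exports.
Local Open Scope ring_scope.
Local Open Scope classical_set_scope.

Section Defs.
Variables (R : realType) (n : nat).

Definition evec (i : 'I_n) : 'rV[R]_n := delta_mx 0 i.

Definition dpart (i : 'I_n) (f : 'rV[R]_n -> R) : 'rV[R]_n -> R :=
  fun x => derive f x (evec i).

Definition iter_partial (ds : seq 'I_n) (f : 'rV[R]_n -> R) := foldr dpart f ds.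

Definition smooth_on (U : set 'rV[R]_n) (f : 'rV[R]_n -> R) : Prop :=
  forall (ds : seq 'I_n) (x : 'rV[R]_n), U x ->
    (forall i, derivable (iter_partial ds f) x (evec i)) /\
    {for x, continuous (iter_partial ds f)}.

Definition dx (i : 'I_n) (G : 'rV[R]_n -> 'rV[R]_n -> R) : 'rV[R]_n -> 'rV[R]_n -> R :=
  fun x xi => derive (fun y => G y xi) x (evec i).
Definition dxi (i : 'I_n) (G : 'rV[R]_n -> 'rV[R]_n -> R) : 'rV[R]_n -> 'rV[R]_n -> R :=
  fun x xi => derive (G x) xi (evec i).

Definition dX (a : 'I_n -> nat) G :=
  foldr (fun i H => iter (a i) (dx i) H) G (enum 'I_n).
Definition dXi (b : 'I_n -> nat) G :=
  foldr (fun i H => iter (b i) (dxi i) H) G (enum 'I_n).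

Definition mlen (a : 'I_n -> nat) : nat := (\sum_i a i)%N.

Definition mdeg (m : nat) (a : {ffun 'I_n -> 'I_m.+1}) : nat := (\sum_i (a i : nat))%N.
Definition monom (m : nat) (xi : 'rV[R]_n) (a : {ffun 'I_n -> 'I_m.+1}) : R :=
  \prod_i xi 0 i ^+ a i.

Definition symb (m : nat) (c : {ffun 'I_n -> 'I_m.+1} -> 'rV[R]_n -> R) x xi : R :=
  \sum_(a | (mdeg a <= m)%N) c a x * monom xi a.
Definition princ (m : nat) (c : {ffun 'I_n -> 'I_m.+1} -> 'rV[R]_n -> R) x xi : R :=
  \sum_(a | mdeg a == m) c a x * monom xi a.

Definition enorm (xi : 'rV[R]_n) : R := Num.sqrt (\sum_i xi 0 i ^+ 2).
Definition japan (xi : 'rV[R]_n) : R := Num.sqrt (1 + enorm xi ^+ 2).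

(* p = p_re + i p_im ; s = |p - z|^2 with z = zr + i zi *)
Definition sq_dist (m : nat) (ar ai : {ffun 'I_n -> 'I_m.+1} -> 'rV[R]_n -> R) (zr zi : R)
  x xi : R := (symb ar x xi - zr) ^+ 2 + (symb ai x xi - zi) ^+ 2.

Definition Lam (m : nat) (ar ai : {ffun 'I_n -> 'I_m.+1} -> 'rV[R]_n -> R) (zr zi alpha : R)
  x xi : R := Num.sqrt ((alpha + sq_dist ar ai zr zi x xi) / (1 + sq_dist ar ai zr zi x xi)).

End Defs.

(* Main.v *)
Require Import Defs.
From HB Require Import structures.
From mathcomp Require Import all_boot all_order all_algebra.
From mathcomp Require Import all_classical all_reals all_analysis.
From mathcomp Require Import ring lra.
Import Order.TTheory GRing.Theory Num.Theory.
Import numFieldNormedType.Exports.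
Local Open Scope ring_scope.
Local Open Scope classical_set_scope.
Set Implicit Arguments. Unset Strict Implicit.

(* Write q = p - z, so that s = |q|^2, and let W = (alpha + s)^(1/2).  Then
   |q| <= W, and ellipticity gives <xi>^m <~ (1 + s)^(1/2) = W / Lambda; hence
   the classical estimates d_x^a d_xi^b q = O(<xi>^(m-|b|)) of the symbol q
   improve to O(W Lambda^(-|a|-|b|) <xi>^(-|b|)) for every derivative of positive
   order, while the function itself is bounded by W.  By the Leibniz rule s then
   obeys these estimates with weight W^2 = alpha + s.  Finally each derivative of
   (1 + s/alpha)^l is (l/alpha) (1 + s/alpha)^(l-1) times a derivative of s,
   and (alpha + s)/alpha = 1 + s/alpha, so by induction on the order the weight
   (1 + s/alpha)^l is preserved and every derivative costs a factor 1/Lambda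
   (times <xi>^-1 for a derivative in xi).  All bounds are uniform for
   0 < alpha <= 1 and x in a compact subset of the coordinate patch U. *)

Section ChainRule.
Variables (R : realType) (V : normedModType R).

Lemma derive_lineE (f : V -> R) x v :
  'D_v f x = derive (fun h : R => f (h *: v + x)) 0 1.
Proof.
rewrite /derive; set g1 := fun h => h^-1 *: _; set g2 := fun h => h^-1 *: _.
suff -> : g1 = g2 by [].
by rewrite funeqE /g1 /g2 => h /=; rewrite addr0 scale0r add0r [_%:A]mulr1.
Qed.

Lemma derive_comp_real (f : V -> R) (g : R -> R) x v dg :
  derivable f x v -> is_derive (f x) 1 g dg ->
  derivable (g \o f) x v /\ 'D_v (g \o f) x = dg * 'D_v f x.
Proof.
move=> df [dgv dgval].
have f0 : (fun h : R => f (h *: v + x)) 0 = f x by rewrite /= scale0r add0r.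
have df1 := (derivable1P f x v).1 df.
have dg1 : derivable g ((fun h : R => f (h *: v + x)) 0) 1 by rewrite f0.
split.
  apply/derivable1P; apply/derivable1_diffP.
  by apply: (@differentiable_comp _ _ _ _ (fun h : R => f (h *: v + x)) g);
    exact/derivable1_diffP.
rewrite (derive_lineE (g \o f)) (derive_lineE f).
by have := derive1_comp df1 dg1; rewrite /= !derive1E f0 dgval.
Qed.

End ChainRule.

Section PartialDerivatives.
Variables (R : realType) (n : nat) (U : set 'rV[R]_n).
Hypothesis oU : open U.
Local Notation V := 'rV[R]_n.

Definition pderiv (o : bool * 'I_n) (H : V -> V -> R) : V -> V -> R :=
  if o.1 then dx o.2 H else dxi o.2 H.
Definition pderivable (o : bool * 'I_n) (H : V -> V -> R) x xi : Prop :=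
  if o.1 then derivable (fun y => H y xi) x (evec R o.2)
  else derivable (H x) xi (evec R o.2).
Definition pderivs (ds : seq (bool * 'I_n)) H := foldr pderiv H ds.
Definition eq_on (H1 H2 : V -> V -> R) := forall x xi, U x -> H1 x xi = H2 x xi.

Definition addF (F G : V -> V -> R) : V -> V -> R := fun x xi => F x xi + G x xi.
Definition mulF (F G : V -> V -> R) : V -> V -> R := fun x xi => F x xi * G x xi.
Definition scaleF (c : R) (F : V -> V -> R) : V -> V -> R := fun x xi => c * F x xi.
Definition cstF (c : R) : V -> V -> R := fun _ _ => c.

Lemma eq_on_sym H1 H2 : eq_on H1 H2 -> eq_on H2 H1.
Proof. by move=> e x xi Ux; rewrite e. Qed.

Lemma eq_on_trans H1 H2 H3 : eq_on H1 H2 -> eq_on H2 H3 -> eq_on H1 H3.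
Proof. by move=> e1 e2 x xi Ux; rewrite e1 // e2. Qed.

Lemma eq_on_pderiv o H1 H2 : eq_on H1 H2 -> eq_on (pderiv o H1) (pderiv o H2).
Proof.
move=> e x xi Ux; case: o => [[] i]; rewrite /pderiv /=.
  rewrite /dx; apply: near_eq_derive.
  by near=> y; apply: e; near: y; exact: open_nbhs_nbhs.
by rewrite /dxi; congr (derive _ _ _); apply/funext => eta; exact: e.
Unshelve. all: by end_near. Qed.

Lemma eq_on_pderivs ds H1 H2 : eq_on H1 H2 -> eq_on (pderivs ds H1) (pderivs ds H2).
Proof. by move=> e; elim: ds => [|o ds IH] //=; apply: eq_on_pderiv. Qed.

Lemma eq_on_pderivable o H1 H2 x xi :
  eq_on H1 H2 -> U x -> pderivable o H1 x xi -> pderivable o H2 x xi.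
Proof.
move=> e Ux; case: o => [[] i]; rewrite /pderivable /=.
  apply: near_eq_derivable.
  by near=> y; apply: e; near: y; exact: open_nbhs_nbhs.
by have -> : H2 x = H1 x by apply/funext => eta; rewrite e.
Unshelve. all: by end_near. Qed.

Lemma pderivD o F G x xi : pderivable o F x xi -> pderivable o G x xi ->
  pderivable o (addF F G) x xi /\
  pderiv o (addF F G) x xi = pderiv o F x xi + pderiv o G x xi.
Proof.
case: o => [[] i]; rewrite /pderivable /pderiv /dx /dxi /addF /= => dF dG;
  by split; [exact: derivableD dF dG | exact: deriveD dF dG].
Qed.

Lemma pderivM o F G x xi : pderivable o F x xi -> pderivable o G x xi ->
  pderivable o (mulF F G) x xi /\
  pderiv o (mulF F G) x xi = pderiv o F x xi * G x xi + F x xi * pderiv o G x xi.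
Proof.
case: o => [[] i]; rewrite /pderivable /pderiv /dx /dxi /mulF /= => dF dG;
  (split; first exact: derivableM dF dG);
  by have := deriveM dF dG => /= ->; rewrite addrC mulrC.
Qed.

Lemma pderivZ o c F x xi : pderivable o F x xi ->
  pderivable o (scaleF c F) x xi /\ pderiv o (scaleF c F) x xi = c * pderiv o F x xi.
Proof.
case: o => [[] i]; rewrite /pderivable /pderiv /dx /dxi /scaleF /= => dF; split;
  by [exact: (derivableM (derivable_cst c _ _) dF) | exact: (@deriveMl _ _ _ c _ _ dF)].
Qed.

Lemma pderiv_cst o c : pderiv o (cstF c) = cstF 0.
Proof.
apply/funext => x; apply/funext => xi.
by case: o => [[] i]; rewrite /pderiv /dx /dxi /cstF /=; exact: derive_cst.
Qed.

Lemma pderivable_cst o c x xi : pderivable o (cstF c) x xi.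
Proof. by case: o => [[] i]; exact: derivable_cst. Qed.

Lemma pderivs_cst ds c : pderivs ds (cstF c) = cstF (if ds is [::] then c else 0).
Proof. by elim: ds => [|o ds IH] //=; rewrite IH; exact: pderiv_cst. Qed.

Lemma pderivs_rcons ds o H : pderivs (rcons ds o) H = pderivs ds (pderiv o H).
Proof. by rewrite /pderivs foldr_rcons. Qed.

(* Note the shift: all partial derivatives of order [<= N.+1] exist on [U]. *)
Definition derivable_upto N H := forall ds, (size ds <= N)%N ->
  forall o x xi, U x -> pderivable o (pderivs ds H) x xi.

Lemma derivable_upto_le N M H : (N <= M)%N -> derivable_upto M H -> derivable_upto N H.
Proof. by move=> NM dH ds sds; apply: dH; apply: leq_trans NM. Qed.

Lemma derivable_upto_pderiv N o H : derivable_upto N.+1 H -> derivable_upto N (pderiv o H).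
Proof.
move=> dH ds sds o' x xi Ux; rewrite -pderivs_rcons.
by apply: dH => //; rewrite size_rcons.
Qed.

Lemma derivable_uptoS N H : derivable_upto 0 H ->
  (forall o, derivable_upto N (pderiv o H)) -> derivable_upto N.+1 H.
Proof.
move=> d0 dS; case/lastP => [|ds o] sds; first exact: d0.
by rewrite size_rcons ltnS in sds; rewrite pderivs_rcons; exact: dS.
Qed.

Lemma pderivsD N F G : derivable_upto N F -> derivable_upto N G ->
  forall ds, (size ds <= N.+1)%N ->
  eq_on (pderivs ds (addF F G)) (addF (pderivs ds F) (pderivs ds G)).
Proof.
move=> dF dG; elim=> [|o ds IH] //= sds.
apply: eq_on_trans; first exact/eq_on_pderiv/IH/ltnW.
by move=> x xi Ux; exact: (pderivD (dF _ sds _ _ _ Ux) (dG _ sds _ _ _ Ux)).2.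
Qed.

Lemma derivable_uptoD N F G : derivable_upto N F -> derivable_upto N G ->
  derivable_upto N (addF F G).
Proof.
move=> dF dG ds sds o x xi Ux.
apply: (eq_on_pderivable (eq_on_sym (pderivsD dF dG (leqW sds)))) => //.
exact: (pderivD (dF _ sds _ _ _ Ux) (dG _ sds _ _ _ Ux)).1.
Qed.

Lemma pderivsZ N c F : derivable_upto N F ->
  forall ds, (size ds <= N.+1)%N ->
  eq_on (pderivs ds (scaleF c F)) (scaleF c (pderivs ds F)).
Proof.
move=> dF; elim=> [|o ds IH] //= sds.
apply: eq_on_trans; first exact/eq_on_pderiv/IH/ltnW.
by move=> x xi Ux; exact: (pderivZ c (dF _ sds _ _ _ Ux)).2.
Qed.

Lemma derivable_uptoZ N c F : derivable_upto N F -> derivable_upto N (scaleF c F).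
Proof.
move=> dF ds sds o x xi Ux.
apply: (eq_on_pderivable (eq_on_sym (pderivsZ c dF (leqW sds)))) => //.
exact: (pderivZ c (dF _ sds _ _ _ Ux)).1.
Qed.

Lemma eq_on_pderivM o F G : derivable_upto 0 F -> derivable_upto 0 G ->
  eq_on (pderiv o (mulF F G)) (addF (mulF (pderiv o F) G) (mulF F (pderiv o G))).
Proof.
by move=> dF dG x xi Ux; exact: (pderivM (dF [::] isT o _ _ Ux) (dG [::] isT o _ _ Ux)).2.
Qed.

Lemma derivable_uptoM N F G : derivable_upto N F -> derivable_upto N G ->
  derivable_upto N (mulF F G).
Proof.
elim: N F G => [|N IH] F G dF dG.
  case=> // _ o x xi Ux.
  exact: (pderivM (dF [::] isT o _ _ Ux) (dG [::] isT o _ _ Ux)).1.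
have dF0 := derivable_upto_le (leq0n N.+1) dF.
have dG0 := derivable_upto_le (leq0n N.+1) dG.
apply: derivable_uptoS; first by case=> // _ o x xi Ux;
  exact: (pderivM (dF [::] isT o _ _ Ux) (dG [::] isT o _ _ Ux)).1.
move=> o ds sds o' x xi Ux.
apply: (eq_on_pderivable (eq_on_pderivs ds (eq_on_sym (eq_on_pderivM o dF0 dG0)))) => //.
have dFG : derivable_upto N (mulF (pderiv o F) G).
  by apply: IH; [exact: derivable_upto_pderiv | exact: derivable_upto_le (leqnSn N) dG].
have dGF : derivable_upto N (mulF F (pderiv o G)).
  by apply: IH; [exact: derivable_upto_le (leqnSn N) dF | exact: derivable_upto_pderiv].
exact: (derivable_uptoD dFG dGF).
Qed.

Lemma derivable_upto_cst N c : derivable_upto N (cstF c).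
Proof. by move=> ds _ o x xi _; rewrite pderivs_cst; exact: pderivable_cst. Qed.

End PartialDerivatives.

Section Bounds.
Variables (R : realType) (n : nat) (U : set 'rV[R]_n).
Hypothesis oU : open U.
Local Notation V := 'rV[R]_n.
Variables (K : set V) (rho : bool * 'I_n -> R -> V -> V -> R).
Hypothesis KU : K `<=` U.
Hypothesis rho_ge0 : forall o a x xi, 0 <= rho o a x xi.

(* Families [F a] indexed by the small parameter [a] (the paper's alpha);
   each derivation [o] costs the factor [rho o a x xi]. *)
Definition rhos ds a x xi := \prod_(o <- ds) rho o a x xi.

Lemma rhos_rcons ds o a x xi : rhos (rcons ds o) a x xi = rhos ds a x xi * rho o a x xi.
Proof. by rewrite /rhos big_rcons. Qed.

Lemma rhos_ge0 ds a x xi : 0 <= rhos ds a x xi.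
Proof. by apply: prodr_ge0 => o _; exact: rho_ge0. Qed.

Definition bounded_upto N (F w : R -> V -> V -> R) := forall ds, (size ds <= N)%N ->
  exists2 C : R, 0 <= C & forall a x xi, 0 < a -> a <= 1 -> K x ->
    `|pderivs ds (F a) x xi| <= C * w a x xi * rhos ds a x xi.

Definition fderivable_upto N (F : R -> V -> V -> R) :=
  forall a, 0 < a -> derivable_upto U N (F a).

Definition add_fam (F G : R -> V -> V -> R) := fun a => addF (F a) (G a).
Definition mul_fam (F G : R -> V -> V -> R) := fun a => mulF (F a) (G a).
Definition pderiv_fam o (F : R -> V -> V -> R) := fun a => pderiv o (F a).

Lemma bounded_upto_le N M F w : (N <= M)%N -> bounded_upto M F w -> bounded_upto N F w.
Proof. by move=> NM B ds sds; apply: B; apply: leq_trans NM. Qed.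

Lemma fderivable_upto_le N M F : (N <= M)%N -> fderivable_upto M F -> fderivable_upto N F.
Proof. by move=> NM dF a a0; apply: derivable_upto_le NM (dF a a0). Qed.

Lemma fderivable_upto_pderiv N o F : fderivable_upto N.+1 F -> fderivable_upto N (pderiv_fam o F).
Proof. by move=> dF a a0; exact: derivable_upto_pderiv (dF a a0). Qed.

Lemma fderivable_uptoD N F G : fderivable_upto N F -> fderivable_upto N G ->
  fderivable_upto N (add_fam F G).
Proof. by move=> dF dG a a0; exact: derivable_uptoD (dF a a0) (dG a a0). Qed.

Lemma fderivable_uptoM N F G : fderivable_upto N F -> fderivable_upto N G ->
  fderivable_upto N (mul_fam F G).
Proof. by move=> dF dG a a0; exact: derivable_uptoM (dF a a0) (dG a a0). Qed.

Lemma fderivable_uptoZ N (c : R -> R) F : fderivable_upto N F ->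
  fderivable_upto N (fun a => scaleF (c a) (F a)).
Proof. by move=> dF a a0; exact: derivable_uptoZ (dF a a0). Qed.

Lemma fderivable_upto_cst N (c : R -> R) : fderivable_upto N (fun a => cstF (c a)).
Proof. by move=> a a0; exact: derivable_upto_cst. Qed.

Lemma bounded_upto_pderiv N o F w : bounded_upto N.+1 F w ->
  bounded_upto N (pderiv_fam o F) (fun a x xi => w a x xi * rho o a x xi).
Proof.
move=> B ds sds; have [|C C0 HC] := B (rcons ds o); first by rewrite size_rcons.
exists C => // a x xi a0 a1 Kx; have := HC a x xi a0 a1 Kx.
rewrite pderivs_rcons rhos_rcons /pderiv_fam.
by have -> : C * (w a x xi * rho o a x xi) * rhos ds a x xi =
  C * w a x xi * (rhos ds a x xi * rho o a x xi) by ring.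
Qed.

Lemma bounded_uptoS N F w : bounded_upto 0 F w ->
  (forall o, bounded_upto N (pderiv_fam o F) (fun a x xi => w a x xi * rho o a x xi)) ->
  bounded_upto N.+1 F w.
Proof.
move=> B0 BS; case/lastP => [|ds o] sds; first exact: B0.
rewrite size_rcons ltnS in sds.
have [C C0 H] := BS o ds sds; exists C => // a x xi a0 a1 Kx.
rewrite pderivs_rcons rhos_rcons.
have -> : C * w a x xi * (rhos ds a x xi * rho o a x xi) =
  C * (w a x xi * rho o a x xi) * rhos ds a x xi by ring.
exact: H.
Qed.

Lemma bounded_upto_weight N F w w' (c : R) : 0 <= c ->
  (forall a x xi, 0 < a -> a <= 1 -> K x -> w a x xi <= c * w' a x xi) ->
  bounded_upto N F w -> bounded_upto N F w'.
Proof.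
move=> c0 ww B ds sds; have [C C0 HC] := B ds sds.
exists (C * c); first exact: mulr_ge0.
move=> a x xi a0 a1 Kx; apply: le_trans (HC a x xi a0 a1 Kx) _.
rewrite -!mulrA ler_wpM2l // mulrA.
by apply: ler_wpM2r; [exact: rhos_ge0 | exact: ww].
Qed.

Lemma bounded_upto_eq_on N F G w : (forall a, 0 < a -> eq_on U (F a) (G a)) ->
  bounded_upto N F w -> bounded_upto N G w.
Proof.
move=> e B ds sds; have [C C0 H] := B ds sds; exists C => // a x xi a0 a1 Kx.
by rewrite -(eq_on_pderivs oU ds (e a a0) xi (KU Kx)); exact: H.
Qed.

Lemma bounded_uptoD N F G w : fderivable_upto N F -> fderivable_upto N G ->
  bounded_upto N F w -> bounded_upto N G w -> bounded_upto N (add_fam F G) w.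
Proof.
move=> dF dG BF BG ds sds.
have [C1 C10 H1] := BF ds sds; have [C2 C20 H2] := BG ds sds.
exists (C1 + C2); first exact: addr_ge0.
move=> a x xi a0 a1 Kx.
rewrite /add_fam (pderivsD oU (dF a a0) (dG a a0) (leqW sds) xi (KU Kx)) /addF.
apply: le_trans (ler_normD _ _) _.
by rewrite !mulrDl; apply: lerD; [exact: H1 | exact: H2].
Qed.

Lemma bounded_uptoZ N (c : R -> R) F w : fderivable_upto N F -> bounded_upto N F w ->
  bounded_upto N (fun a => scaleF (c a) (F a)) (fun a x xi => `|c a| * w a x xi).
Proof.
move=> dF BF ds sds; have [C C0 H] := BF ds sds.
exists C => // a x xi a0 a1 Kx.
rewrite (pderivsZ oU (c a) (dF a a0) (leqW sds) xi (KU Kx)) /scaleF normrM.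
by rewrite mulrCA -!mulrA ler_wpM2l // mulrA; exact: H.
Qed.

Lemma bounded_upto_cst N (c : R -> R) (B : R) :
  (forall a, 0 < a -> a <= 1 -> `|c a| <= B) ->
  bounded_upto N (fun a => cstF (c a)) (fun _ _ _ => 1).
Proof.
move=> cB ds _; exists (Num.max B 0); first by rewrite le_max lexx orbT.
move=> a x xi a0 a1 Kx; rewrite pderivs_cst mulr1 /cstF.
case: ds => [|o ds].
  by rewrite /rhos big_nil mulr1; apply: le_trans (cB a a0 a1) _; rewrite le_max lexx.
by rewrite normr0 mulr_ge0 ?rhos_ge0 // le_max lexx orbT.
Qed.

Lemma bounded_uptoM0 F G w1 w2 : bounded_upto 0 F w1 -> bounded_upto 0 G w2 ->
  bounded_upto 0 (mul_fam F G) (mul_fam w1 w2).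
Proof.
move=> BF BG [|//] _.
have [C1 C10 H1] := BF [::] isT; have [C2 C20 H2] := BG [::] isT.
exists (C1 * C2); first exact: mulr_ge0.
move=> a x xi a0 a1 Kx; have := H1 a x xi a0 a1 Kx; have := H2 a x xi a0 a1 Kx.
rewrite /mul_fam /mulF /rhos /= big_nil normrM !mulr1 => h2 h1.
rewrite mulrACA; exact: ler_pM.
Qed.

Lemma bounded_uptoM N F G w1 w2 : fderivable_upto N F -> fderivable_upto N G ->
  bounded_upto N F w1 -> bounded_upto N G w2 -> bounded_upto N (mul_fam F G) (mul_fam w1 w2).
Proof.
elim: N F G w1 w2 => [|N IH] F G w1 w2 dF dG BF BG; first exact: bounded_uptoM0.
apply: bounded_uptoS.
  by apply: bounded_uptoM0; [exact: bounded_upto_le (leq0n _) BF |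
    exact: bounded_upto_le (leq0n _) BG].
move=> o.
have dF' := fderivable_upto_le (leqnSn N) dF; have dG' := fderivable_upto_le (leqnSn N) dG.
have B1 := IH _ _ _ _ (fderivable_upto_pderiv o dF) dG' (bounded_upto_pderiv o BF)
  (bounded_upto_le (leqnSn N) BG).
have B2 := IH _ _ _ _ dF' (fderivable_upto_pderiv o dG) (bounded_upto_le (leqnSn N) BF)
  (bounded_upto_pderiv o BG).
pose w a x xi := mul_fam w1 w2 a x xi * rho o a x xi.
have B1' : bounded_upto N (mul_fam (pderiv_fam o F) G) w.
  by apply: (bounded_upto_weight (c := 1)) ler01 _ B1 => a x xi _ _ _;
    rewrite /w /mul_fam /mulF mul1r mulrAC.
have B2' : bounded_upto N (mul_fam F (pderiv_fam o G)) w.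
  by apply: (bounded_upto_weight (c := 1)) ler01 _ B2 => a x xi _ _ _;
    rewrite /w /mul_fam /mulF mul1r mulrA.
have := bounded_uptoD (fderivable_uptoM (fderivable_upto_pderiv o dF) dG')
  (fderivable_uptoM dF' (fderivable_upto_pderiv o dG)) B1' B2'.
apply: bounded_upto_eq_on => a a0; apply: eq_on_sym.
exact: (eq_on_pderivM o (derivable_upto_le (leq0n _) (dF a a0))
  (derivable_upto_le (leq0n _) (dG a a0))).
Qed.

End Bounds.

Lemma is_derive_relpow (R : realType) (a e u : R) : 0 < 1 + u / a ->
  is_derive u 1 (fun u => (1 + u / a) `^ e) (e * (1 + u / a) `^ (e - 1) / a).
Proof.
move=> pos.
have dlin : is_derive u 1 (fun u : R => 1 + u / a) a^-1.
  apply: is_derive_eq.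
  by rewrite add0r mul1r scaler0 add0r /GRing.scale /= mulr1.
have [dd ed] := derive_comp_real (@ex_derive _ _ _ _ _ _ _ dlin) (is_derive1_powR e pos).
apply: DeriveDef; first exact: dd.
by rewrite ed (@derive_val _ _ _ _ _ _ _ dlin).
Qed.

Section RelativePower.
Variables (R : realType) (n : nat) (U : set 'rV[R]_n).
Hypothesis oU : open U.
Local Notation V := 'rV[R]_n.
Variables (K : set V) (rho : bool * 'I_n -> R -> V -> V -> R).
Hypothesis KU : K `<=` U.
Hypothesis rho_ge0 : forall o a x xi, 0 <= rho o a x xi.
Variable s : V -> V -> R.
Hypothesis s_ge0 : forall x xi, U x -> 0 <= s x xi.
Hypothesis s_derivable : forall N, derivable_upto U N s.
Hypothesis s_bounded : forall N, bounded_upto K rho N (fun _ => s) (fun a x xi => a + s x xi).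

Definition relpow (e : R) : R -> V -> V -> R := fun a x xi => (1 + s x xi / a) `^ e.

Lemma relpow_base_gt0 a x xi : 0 < a -> U x -> 0 < 1 + s x xi / a.
Proof. by move=> a0 Ux; have := divr_ge0 (s_ge0 xi Ux) (ltW a0); lra. Qed.

Lemma pderiv_relpow e a o x xi : 0 < a -> U x -> pderivable o s x xi ->
  pderivable o (relpow e a) x xi /\
  pderiv o (relpow e a) x xi = e / a * relpow (e - 1) a x xi * pderiv o s x xi.
Proof.
move=> a0 Ux; have dpow := is_derive_relpow e (relpow_base_gt0 xi a0 Ux).
case: o => [[] i]; rewrite /pderivable /pderiv /dx /dxi /= => ds;
  have [dd ed] := derive_comp_real ds dpow; split => //;
  by apply: (eq_trans ed); rewrite /relpow; ring.
Qed.

Lemma eq_on_pderiv_relpow e a o : 0 < a ->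
  eq_on U (pderiv o (relpow e a)) (mulF (scaleF (e / a) (relpow (e - 1) a)) (pderiv o s)).
Proof.
by move=> a0 x xi Ux; exact: (pderiv_relpow e a0 Ux (@s_derivable 0%N [::] isT o x xi Ux)).2.
Qed.

Lemma fderivable_relpow N e : fderivable_upto U N (relpow e).
Proof.
have d0 e' a : 0 < a -> derivable_upto U 0 (relpow e' a).
  by move=> a0 [] // _ o x xi Ux;
    exact: (pderiv_relpow e' a0 Ux (@s_derivable 0%N [::] isT o x xi Ux)).1.
elim: N e => [|N IH] e a a0; first exact: d0.
apply: derivable_uptoS => [|o]; first exact: d0.
move=> ds sds o' x xi Ux.
apply: (eq_on_pderivable oU (eq_on_pderivs oU ds (eq_on_sym (eq_on_pderiv_relpow e o a0)))) => //.
have dZ := derivable_uptoZ oU (e / a) (IH (e - 1) a a0).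
exact: (derivable_uptoM oU dZ (derivable_upto_pderiv o (@s_derivable N.+1))).
Qed.

(* Each derivative of [(1 + s/a)^e] brings down [e/a * d s], and [|d s|] is
   bounded by [(a + s) rho], so that [1/a * (a + s) = 1 + s/a] restores the weight. *)
Lemma bounded_relpow N e : bounded_upto K rho N (relpow e) (relpow e).
Proof.
have B0 e' : bounded_upto K rho 0 (relpow e') (relpow e').
  case=> // _; exists 1 => // a x xi a0 a1 Kx.
  by rewrite /rhos big_nil !mul1r mulr1 ger0_norm // powR_ge0.
elim: N e => [|N IH] e; first exact: B0.
apply: bounded_uptoS => [|o]; first exact: B0.
have BM := bounded_uptoM oU KU rho_ge0
  (fderivable_uptoZ oU (fun a => e / a) (fderivable_relpow (N := N) (e - 1)))
  (fderivable_upto_pderiv o (fun a _ => @s_derivable N.+1))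
  (bounded_uptoZ oU KU (fun a => e / a) (fderivable_relpow (N := N) (e - 1)) (IH (e - 1)))
  (bounded_upto_pderiv o (@s_bounded N.+1)).
have {}BM := bounded_upto_eq_on oU KU (G := pderiv_fam o (relpow e))
  (fun a a0 => eq_on_sym (eq_on_pderiv_relpow e o a0)) BM.
apply: (bounded_upto_weight rho_ge0 (c := `|e|)) _ _ BM => // a x xi a0 a1 Kx.
have pb := relpow_base_gt0 xi a0 (KU Kx).
have -> : relpow e a x xi = relpow (e - 1) a x xi * (1 + s x xi / a).
  rewrite /relpow -[X in _ = _ * X](powRr1 (ltW pb)) -powRD ?subrK //.
  by apply/implyP => _; rewrite gt_eqF.
rewrite /mul_fam /mulF normrM normfV (gtr0_norm a0) le_eqVlt; apply/orP; left; apply/eqP.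
by field; rewrite gt_eqF.
Qed.

End RelativePower.

Lemma compact_bounded_fun (R : realType) (n : nat) (K : set 'rV[R]_n) (f : 'rV[R]_n -> R) :
  compact K -> (forall x, K x -> {for x, continuous f}) ->
  exists M, forall x, K x -> `|f x| <= M.
Proof.
move=> cK fc.
have [K0|K0] := pselect (K !=set0); last first.
  by exists 0 => x Kx; exfalso; apply: K0; exists x.
have cn : {within K, continuous (Num.norm \o f)}.
  apply: continuous_in_subspaceT => x; rewrite inE => Kx.
  by apply: continuous_comp; [exact: fc | exact: norm_continuous].
have [c Kc H] := EVT_max_rV K0 cK cn.
by exists `|f c| => x Kx; exact: (H x (mem_set Kx)).
Qed.

Section Japan.
Variables (R : realType) (n : nat).
Implicit Types xi : 'rV[R]_n.

Lemma japan_ge1 xi : 1 <= japan xi.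
Proof.
rewrite /japan -{1}sqrtr1 ler_sqrt; last by rewrite addr_ge0 // sqr_ge0.
by rewrite lerDl sqr_ge0.
Qed.

Lemma japan_gt0 xi : 0 < japan xi.
Proof. exact: lt_le_trans (japan_ge1 xi). Qed.

Lemma japan_le1D xi : japan xi <= 1 + enorm xi.
Proof.
have e0 : 0 <= enorm xi by exact: sqrtr_ge0.
rewrite /japan -(ger0_norm (addr_ge0 ler01 e0)) -sqrtr_sqr ler_sqrt ?sqr_ge0 //.
by rewrite !expr2; nra.
Qed.

Lemma coord_le_japan xi j : `|xi 0 j| <= japan xi.
Proof.
apply: (@le_trans _ _ (enorm xi)).
  rewrite /enorm -sqrtr_sqr ler_sqrt; last by apply: sumr_ge0 => i _; exact: sqr_ge0.
  by rewrite (bigD1 j) //= lerDl; apply: sumr_ge0 => i _; exact: sqr_ge0.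
have e0 : 0 <= enorm xi by exact: sqrtr_ge0.
rewrite /japan -[X in X <= _](ger0_norm e0) -sqrtr_sqr ler_sqrt ?addr_ge0 ?sqr_ge0 //.
by rewrite lerDr.
Qed.

Lemma derive_coord xi (i j : 'I_n) :
  derivable (fun eta : 'rV[R]_n => eta 0 j) xi (evec R i) /\
  'D_(evec R i) (fun eta : 'rV[R]_n => eta 0 j) xi = (i == j)%:R.
Proof.
have E : (fun h : R => (h *: evec R i + xi) 0 j) = (fun h => h * (i == j)%:R + xi 0 j).
  by apply/funext => h; rewrite !mxE /evec eqxx /= eq_sym.
have d1 : derivable (fun h : R => h * (i == j)%:R) 0 1.
  exact: (derivableM (@derivable_id _ _ (0:R) 1) (derivable_cst ((i == j)%:R : R) (0:R) 1)).
split; first by apply/derivable1P; rewrite E; exact: derivableD d1 (derivable_cst _ _ _).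
rewrite derive_lineE E.
have := deriveD d1 (derivable_cst (xi 0 j) (0:R) 1) => /= ->.
have := deriveM (@derivable_id _ _ (0:R) 1) (derivable_cst ((i == j)%:R : R) (0:R) 1) => /= ->.
by rewrite !derive_cst derive_id scaler0 add0r addr0 /GRing.scale /= mulr1.
Qed.

End Japan.

Section SymbolClasses.
Variables (R : realType) (n : nat) (U : set 'rV[R]_n).
Hypothesis oU : open U.
Local Notation V := 'rV[R]_n.
Variable K : set V.
Hypothesis KU : K `<=` U.
Hypothesis cK : compact K.

Definition rho_std (o : bool * 'I_n) (a : R) (x xi : V) : R :=
  if o.1 then 1 else (japan xi)^-1.

Lemma rho_std_ge0 o a x xi : 0 <= rho_std o a x xi.
Proof. by rewrite /rho_std; case: o.1; rewrite // invr_ge0 ltW // japan_gt0. Qed.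

Definition smooth_symbol (F w : R -> V -> V -> R) :=
  (forall N, fderivable_upto U N F) /\ (forall N, bounded_upto K rho_std N F w).

Lemma smooth_symbol_ext F G w w' :
  (forall a x xi, F a x xi = G a x xi) -> (forall a x xi, w a x xi = w' a x xi) ->
  smooth_symbol F w -> smooth_symbol G w'.
Proof.
move=> eF ew; have -> : G = F by do 3!apply/funext => ?; rewrite eF.
by have -> : w' = w by do 3!apply/funext => ?; rewrite ew.
Qed.

Lemma smooth_symbol_weight F w w' (c : R) : 0 <= c ->
  (forall a x xi, 0 < a -> a <= 1 -> K x -> w a x xi <= c * w' a x xi) ->
  smooth_symbol F w -> smooth_symbol F w'.
Proof.
by move=> c0 ww [dF BF]; split=> // N; exact (bounded_upto_weight rho_std_ge0 c0 ww (BF N)).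
Qed.

Lemma smooth_symbolD F G w : smooth_symbol F w -> smooth_symbol G w ->
  smooth_symbol (add_fam F G) w.
Proof.
move=> [dF BF] [dG BG]; split=> N; first exact: fderivable_uptoD.
exact (bounded_uptoD oU KU (dF N) (dG N) (BF N) (BG N)).
Qed.

Lemma smooth_symbolM F G w1 w2 : smooth_symbol F w1 -> smooth_symbol G w2 ->
  smooth_symbol (mul_fam F G) (mul_fam w1 w2).
Proof.
move=> [dF BF] [dG BG]; split=> N; first exact: fderivable_uptoM.
exact (bounded_uptoM oU KU rho_std_ge0 (dF N) (dG N) (BF N) (BG N)).
Qed.

Lemma smooth_symbol_cst (c : R -> R) (B : R) : (forall a, 0 < a -> a <= 1 -> `|c a| <= B) ->
  smooth_symbol (fun a => cstF (c a)) (fun _ _ _ => 1).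
Proof.
by move=> cB; split=> N; [exact: fderivable_upto_cst | exact (bounded_upto_cst K rho_std_ge0 cB)].
Qed.

Lemma smooth_symbol0 w : smooth_symbol (fun _ => cstF 0) w.
Proof.
split=> N; first exact: fderivable_upto_cst.
move=> ds _; exists 0 => // a x xi _ _ _.
by rewrite pderivs_cst /cstF; case: ds => [|? ?]; rewrite normr0 !mul0r.
Qed.

Lemma smooth_symbol_le F w : smooth_symbol F w ->
  exists2 C : R, 0 <= C & forall a x xi, 0 < a -> a <= 1 -> K x -> `|F a x xi| <= C * w a x xi.
Proof.
move=> [_ BF]; have [C C0 H] := BF 0%N [::] isT; exists C => // a x xi a0 a1 Kx.
by have := H a x xi a0 a1 Kx; rewrite /rhos big_nil mulr1.
Qed.

Lemma pderivs_coef (c : V -> R) ds :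
  pderivs ds (fun x (_ : V) => c x) =
  if all fst ds then (fun x _ => iter_partial (map snd ds) c x) else cstF 0.
Proof.
elim: ds => [|[[] i] ds IH] //=; rewrite IH.
  by case: (all fst ds) => //; exact: pderiv_cst.
case: (all fst ds) => /=; last exact: pderiv_cst.
by do 2!apply/funext => ?; rewrite /pderiv /dxi /=; exact: derive_cst.
Qed.

Lemma smooth_symbol_coef (c : V -> R) : smooth_on U c ->
  smooth_symbol (fun _ x _ => c x) (fun _ _ _ => 1).
Proof.
move=> sm; split.
  move=> N a a0 ds sds o x xi Ux; rewrite pderivs_coef; case: ifP => al; last exact: pderivable_cst.
  case: o => [[] i]; last exact: derivable_cst.
  exact: (sm (map snd ds) x Ux).1 i.
move=> N ds sds.
have [M HM] := compact_bounded_fun cK (fun x Kx => (sm (map snd ds) x (KU Kx)).2).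
exists (Num.max M 0); first by rewrite le_max lexx orbT.
move=> a x xi a0 a1 Kx; rewrite pderivs_coef; case: ifP => al.
  have -> : rhos rho_std ds a x xi = 1.
    by rewrite /rhos big1_seq // => o /andP[_ /(allP al) o1]; rewrite /rho_std o1.
  by rewrite !mulr1; apply: le_trans (HM x Kx) _; rewrite le_max lexx.
rewrite /cstF normr0 mulr_ge0 ?(rhos_ge0 rho_std_ge0) //.
by rewrite mulr_ge0 // le_max lexx orbT.
Qed.

Definition coordF (j : 'I_n) : V -> V -> R := fun x xi => xi 0 j.

Lemma pderivs_coord ds j : pderivs ds (coordF j) =
  match ds with
  | [::] => coordF j
  | [:: o] => cstF (if o.1 then 0 else (o.2 == j)%:R)
  | _ => cstF 0
  end.
Proof.
have d1 o : pderiv o (coordF j) = cstF (if o.1 then 0 else (o.2 == j)%:R).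
  do 2!apply/funext => ?; case: o => [[] i]; rewrite /pderiv /dx /dxi /coordF /cstF /=.
    exact: derive_cst.
  exact: (derive_coord _ i j).2.
elim: ds => [|o ds IH] //=; rewrite IH.
by case: ds IH => [|o' [|o'' ds]] _ //=; exact: pderiv_cst.
Qed.

Lemma smooth_symbol_coord j : smooth_symbol (fun _ => coordF j) (fun _ _ xi => japan xi).
Proof.
split.
  move=> N a a0 ds sds o x xi Ux; rewrite pderivs_coord.
  case: ds sds => [|o1 [|o2 ds]] _ /=; [ | exact: pderivable_cst | exact: pderivable_cst].
  case: o => [[] i]; first exact: derivable_cst.
  exact: (derive_coord xi i j).1.
move=> N ds _; exists 1 => // a x xi _ _ _; rewrite pderivs_coord mul1r.
have J0 := japan_gt0 xi.
case: ds => [|o [|o2 ds]] /=.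
- by rewrite /rhos big_nil mulr1; exact: coord_le_japan.
- rewrite /rhos big_seq1 /rho_std /cstF; case: o => [[] i] /=; first by rewrite normr0 mulr1 ltW.
  rewrite divff; last by rewrite gt_eqF.
  by case: (i == j); rewrite ?normr1 ?normr0.
- by rewrite /cstF /= normr0 mulr_ge0 ?(rhos_ge0 rho_std_ge0) // ltW.
Qed.

Lemma smooth_symbol_prod (I : Type) (r : seq I) (F w : I -> R -> V -> V -> R) :
  (forall i, smooth_symbol (F i) (w i)) ->
  smooth_symbol (fun a x xi => \prod_(i <- r) F i a x xi)
                (fun a x xi => \prod_(i <- r) w i a x xi).
Proof.
move=> SF; elim: r => [|k r IH].
  apply: smooth_symbol_ext (smooth_symbol_cst (c := fun _ => 1) (B := 1) _) => *;
    by rewrite ?big_nil ?normr1.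
by apply: smooth_symbol_ext (smooth_symbolM (SF k) IH) => *; rewrite big_cons.
Qed.

Lemma smooth_symbol_exp F w k : smooth_symbol F w ->
  smooth_symbol (fun a x xi => F a x xi ^+ k) (fun a x xi => w a x xi ^+ k).
Proof.
move=> SF; elim: k => [|k IH].
  apply: smooth_symbol_ext (smooth_symbol_cst (c := fun _ => 1) (B := 1) _) => *;
    by rewrite ?expr0 ?normr1.
by apply: smooth_symbol_ext (smooth_symbolM SF IH) => *; rewrite exprS.
Qed.

Lemma smooth_symbol_sum (I : Type) (r : seq I) (P : pred I) (F : I -> R -> V -> V -> R) w :
  (forall i, P i -> smooth_symbol (F i) w) ->
  smooth_symbol (fun a x xi => \sum_(i <- r | P i) F i a x xi) w.
Proof.
move=> SF; elim: r => [|k r IH].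
  by apply: smooth_symbol_ext (smooth_symbol0 w) => *; rewrite ?big_nil.
have [Pk|nPk] := boolP (P k).
  by apply: smooth_symbol_ext (smooth_symbolD (SF k Pk) IH) => *; rewrite ?big_cons ?Pk.
by apply: smooth_symbol_ext IH => *; rewrite ?big_cons ?(negbTE nPk).
Qed.

Lemma smooth_symbol_monom (m : nat) (b : {ffun 'I_n -> 'I_m.+1}) :
  smooth_symbol (fun _ _ xi => monom xi b) (fun _ _ xi => japan xi ^+ mdeg b).
Proof.
have := smooth_symbol_prod (index_enum 'I_n)
  (fun i => smooth_symbol_exp (b i) (smooth_symbol_coord i)).
by apply: smooth_symbol_ext => // *; rewrite prodrXr.
Qed.

Lemma smooth_symbol_poly (m : nat) (cs : {ffun 'I_n -> 'I_m.+1} -> V -> R)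
    (P : pred {ffun 'I_n -> 'I_m.+1}) d :
  (forall b, P b -> smooth_on U (cs b)) -> (forall b, P b -> (mdeg b <= d)%N) ->
  smooth_symbol (fun _ x xi => \sum_(b | P b) cs b x * monom xi b) (fun _ _ xi => japan xi ^+ d).
Proof.
move=> sm dg; apply: smooth_symbol_sum => b Pb.
apply: (smooth_symbol_weight (c := 1)) ler01 _
  (smooth_symbolM (smooth_symbol_coef (sm b Pb)) (smooth_symbol_monom b)).
move=> a x xi _ _ _; rewrite /mul_fam /mulF !mul1r.
by apply: ler_weXn2l; [exact: japan_ge1 | exact: dg].
Qed.

End SymbolClasses.

Section RealInequalities.
Variable R : realType.

Lemma exprD1_le (x : R) k : 0 <= x -> (1 + x) ^+ k <= 2 ^+ k * (1 + x ^+ k).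
Proof.
move=> x0; have xk0 := exprn_ge0 k x0.
have [x1|x1] := lerP x 1.
  apply: le_trans (lerXn2r k _ _ (_ : 1 + x <= 2)) _; rewrite ?nnegrE; [lra | lra | lra |].
  by rewrite -[X in X <= _]mulr1 ler_wpM2l ?exprn_ge0 //; lra.
apply: le_trans (lerXn2r k _ _ (_ : 1 + x <= 2 * x)) _; rewrite ?nnegrE; [lra | lra | lra |].
by rewrite exprMn ler_wpM2l ?exprn_ge0 //; lra.
Qed.

(* Either [J <= 2 D], or the term [D J^k] is at most half of [J^(k+1)]. *)
Lemma absorb_power (J D X : R) k : 1 <= J -> 0 <= D -> 0 <= X ->
  J ^+ k.+1 <= X + D * J ^+ k -> J ^+ k.+1 <= 2 * X + (2 * D) ^+ k.+1.
Proof.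
move=> J1 D0 X0 h.
have Jk0 : 0 <= J ^+ k by apply: exprn_ge0; lra.
have DJ0 : 0 <= (2 * D) ^+ k.+1 by apply: exprn_ge0; lra.
have [JD|DJ] := lerP J (2 * D).
  have : J ^+ k.+1 <= (2 * D) ^+ k.+1 by apply: lerXn2r; rewrite ?nnegrE //; lra.
  lra.
have : 2 * D * J ^+ k <= J * J ^+ k by apply: ler_wpM2r => //; exact: ltW.
move: h; rewrite exprS; lra.
Qed.

Lemma sqrt_sqrD_le (P Q : R) : Num.sqrt (P ^+ 2 + Q ^+ 2) <= `|P| + `|Q|.
Proof.
rewrite -(ger0_norm (addr_ge0 (normr_ge0 P) (normr_ge0 Q))) -sqrtr_sqr ler_sqrt ?sqr_ge0 //.
rewrite -[P ^+ 2]real_normK ?num_real // -[Q ^+ 2]real_normK ?num_real //.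
rewrite sqrrD -addrA lerD2l; apply: ler_wpDl => //; apply: mulrn_wge0; exact: mulr_ge0.
Qed.

(* The elliptic estimate [|xi|^(k+1) <~ r + <xi>^k] bootstraps to [<xi>^(k+1) <~ 1 + r]. *)
Lemma elliptic_absorb (k : nat) (C0 B c : R) : 0 < C0 -> 0 <= B -> 0 <= c ->
  exists2 E : R, 0 <= E & forall J e r : R, 1 <= J -> J <= 1 + e -> 0 <= e -> 0 <= r ->
    e ^+ k.+1 <= C0 * (r + B * J ^+ k + c) -> J ^+ k.+1 <= E * (1 + r).
Proof.
move=> C00 B0 c0; set p : R := 2 ^+ k.+1; set D := (2 * (p * C0 * B)) ^+ k.+1.
have p0 : 0 <= p by exact: exprn_ge0.
have D0 : 0 <= D by apply: exprn_ge0; rewrite !mulr_ge0 //; lra.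
have pC0 : 0 <= p * C0 by rewrite mulr_ge0 //; lra.
have pC0c : 0 <= p * C0 * c by rewrite mulr_ge0.
exists (2 * p + 2 * p * C0 * c + 2 * p * C0 + D) => [|J e r J1 Je e0 r0 he].
  by rewrite !addr_ge0 // !mulr_ge0 //; lra.
have Jk0 : 0 <= J ^+ k by apply: exprn_ge0; lra.
have hJ : J ^+ k.+1 <= p * (1 + C0 * (r + c)) + p * C0 * B * J ^+ k.
  apply: le_trans (lerXn2r k.+1 _ _ Je) _; rewrite ?nnegrE; [lra | lra |].
  apply: le_trans (exprD1_le k.+1 e0) _; rewrite -/p.
  suff : p * e ^+ k.+1 <= p * (C0 * (r + B * J ^+ k + c)) by move=> h; nra.
  exact: ler_wpM2l.
have X0 : 0 <= p * (1 + C0 * (r + c)) by rewrite mulr_ge0 // addr_ge0 // mulr_ge0 ?addr_ge0 //; lra.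
apply: le_trans (absorb_power J1 _ X0 hJ) _; first by rewrite !mulr_ge0 //; lra.
rewrite -/D; have rD : 0 <= r * D by exact: mulr_ge0.
have rp : 0 <= r * (p + p * C0 * c) by rewrite mulr_ge0 // addr_ge0.
nra.
Qed.

End RealInequalities.

Section TradeWeight.
Variables (R : realType) (n : nat).
Local Notation V := 'rV[R]_n.
Variables (K : set V) (rho : bool * 'I_n -> R -> V -> V -> R) (L : R -> V -> V -> R).
Hypothesis rho_ge0 : forall o a x xi, 0 <= rho o a x xi.
Hypothesis L_gt0 : forall a x xi, 0 < a -> a <= 1 -> K x -> 0 < L a x xi.
Hypothesis L_le1 : forall a x xi, 0 < a -> a <= 1 -> K x -> L a x xi <= 1.

Definition rhoL o a x xi := (L a x xi)^-1 * rho o a x xi.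

Lemma rhos_rhoL ds a x xi : rhos rhoL ds a x xi = L a x xi ^- size ds * rhos rho ds a x xi.
Proof.
elim: ds => [|o ds IH]; first by rewrite /rhos !big_nil expr0 invr1 mul1r.
by rewrite /rhos !big_cons -!/(rhos _ _ _ _ _) IH /rhoL /= exprS invfM; ring.
Qed.

(* A weight [w] with [w <= E W / L] may be traded for [W], at the price of one
   extra factor [1/L] per derivative; for the function itself one uses [|F| <= W]. *)
Lemma bounded_upto_trade N F w W (E : R) : 0 <= E ->
  (forall a x xi, 0 < a -> a <= 1 -> K x -> `|F a x xi| <= W a x xi) ->
  (forall a x xi, 0 < a -> a <= 1 -> K x -> w a x xi <= E * W a x xi / L a x xi) ->
  bounded_upto K rho N F w -> bounded_upto K rhoL N F W.
Proof.
move=> E0 FW wW B [|o ds] sds.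
  by exists 1 => // a x xi a0 a1 Kx; rewrite /rhos big_nil mulr1 mul1r; exact: FW.
have [C C0 H] := B (o :: ds) sds; exists (C * E); first exact: mulr_ge0.
move=> a x xi a0 a1 Kx; apply: le_trans (H a x xi a0 a1 Kx) _.
have L0 := @L_gt0 a x xi a0 a1 Kx; have L1 := @L_le1 a x xi a0 a1 Kx.
have Li0 : 0 <= (L a x xi)^-1 by rewrite invr_ge0 ltW.
have Lk : 1 <= (L a x xi) ^- (size ds) by rewrite -exprVn exprn_ege1 // invf_ge1.
have M0 : 0 <= rhos rho (o :: ds) a x xi by exact: rhos_ge0.
have W0 : 0 <= W a x xi by apply: le_trans (FW a x xi a0 a1 Kx).
rewrite rhos_rhoL /= exprS invfM.
apply: (@le_trans _ _ (C * (E * W a x xi / L a x xi) * rhos rho (o :: ds) a x xi)).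
  by apply: ler_wpM2r => //; apply: ler_wpM2l => //; exact: wW.
pose P := C * E * W a x xi * ((L a x xi)^-1 * rhos rho (o :: ds) a x xi).
have P0 : 0 <= P by rewrite /P !mulr_ge0.
rewrite [leLHS](_ : _ = P * 1) ?[leRHS](_ : _ = P * L a x xi ^- size ds) ?ler_wpM2l //;
  by rewrite /P; ring.
Qed.

End TradeWeight.

Section MultiIndexDerivations.
Variables (R : realType) (n : nat).
Local Notation V := 'rV[R]_n.

Definition ops (b : bool) (ta : 'I_n -> nat) : seq (bool * 'I_n) :=
  flatten [seq nseq (ta i) (b, i) | i <- enum 'I_n].

Lemma foldr_iter_pderiv b ta r (H : V -> V -> R) :
  foldr (fun i G => iter (ta i) (pderiv (b, i)) G) H r =
  pderivs (flatten [seq nseq (ta i) (b, i) | i <- r]) H.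
Proof.
elim: r => [|i r IH] //=; rewrite IH /pderivs foldr_cat.
by elim: (ta i) => //= k ->.
Qed.

Lemma dX_dXi_pderivs ta tb (H : V -> V -> R) :
  dX ta (dXi tb H) = pderivs (ops true ta ++ ops false tb) H.
Proof. by rewrite /pderivs foldr_cat -!/(pderivs _ _) -!foldr_iter_pderiv. Qed.

Lemma mlen_enum (ta : 'I_n -> nat) : mlen ta = (\sum_(i <- enum 'I_n) ta i)%N.
Proof. by rewrite /mlen big_enum /=; apply: eq_bigl => i. Qed.

Lemma size_ops b ta : size (ops b ta) = mlen ta.
Proof.
rewrite /ops mlen_enum; elim: (enum 'I_n) => [|i r IH]; first by rewrite big_nil.
by rewrite /= size_cat size_nseq IH big_cons.
Qed.

Lemma rhos_std_ops b ta a (x xi : V) :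
  rhos (@rho_std R n) (ops b ta) a x xi = japan xi ^- (if b then 0 else mlen ta).
Proof.
rewrite /rhos /ops mlen_enum; elim: (enum 'I_n) => [|i r IH].
  by rewrite !big_nil; case: b; rewrite expr0 invr1.
rewrite /= big_cat IH big_cons {IH}.
elim: (ta i) => [|k IHk] /=; first by rewrite big_nil mul1r; case: b.
rewrite big_cons -mulrA IHk {IHk} /rho_std /=; case: b; rewrite ?mul1r //.
by rewrite addSn exprS invfM.
Qed.

End MultiIndexDerivations.

Section SqDist.
Variables (R : realType) (n m : nat).
Local Notation V := 'rV[R]_n.
Local Notation FF := {ffun 'I_n -> 'I_m.+1}.
Variables (ar ai : FF -> V -> R) (zr zi : R).
Local Notation s := (sq_dist ar ai zr zi).
Local Notation L := (Lam ar ai zr zi).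

Lemma symb_split (cs : FF -> V -> R) x xi :
  symb cs x xi = princ cs x xi + \sum_(b | (mdeg b < m)%N) cs b x * monom xi b.
Proof.
rewrite /symb /princ (bigID (fun b => mdeg b == m)) /=; congr (_ + _); apply: eq_bigl => b.
  by apply/idP/idP => [/andP[_ ->] // | /eqP h]; rewrite h leqnn eqxx.
by rewrite ltn_neqAle andbC.
Qed.

Lemma sq_dist_ge0 x xi : 0 <= s x xi.
Proof. by rewrite /sq_dist addr_ge0 // sqr_ge0. Qed.

Lemma norm_re_le_sq_dist x xi : `|symb ar x xi - zr| <= Num.sqrt (s x xi).
Proof. by rewrite -sqrtr_sqr ler_sqrt ?sq_dist_ge0 // lerDl sqr_ge0. Qed.

Lemma norm_im_le_sq_dist x xi : `|symb ai x xi - zi| <= Num.sqrt (s x xi).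
Proof. by rewrite -sqrtr_sqr ler_sqrt ?sq_dist_ge0 // lerDr sqr_ge0. Qed.

Lemma Lam_gt0 a x xi : 0 < a -> 0 < L a x xi.
Proof.
by move=> a0; have s0 := sq_dist_ge0 x xi; rewrite sqrtr_gt0 divr_gt0 //; lra.
Qed.

Lemma Lam_le1 a x xi : a <= 1 -> L a x xi <= 1.
Proof.
move=> a1; have := sq_dist_ge0 x xi => s0.
by rewrite -sqrtr1 ler_sqrt // ler_pdivrMr; lra.
Qed.

Lemma sqrt_sq_distD_divLam a x xi : 0 < a ->
  Num.sqrt (a + s x xi) / L a x xi = Num.sqrt (1 + s x xi).
Proof.
move=> a0; have := sq_dist_ge0 x xi => s0.
rewrite /Lam sqrtrM ?sqrtrV; [|lra|lra].
have : 0 < Num.sqrt (a + s x xi) by rewrite sqrtr_gt0; lra.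
have : 0 < Num.sqrt (1 + s x xi) by rewrite sqrtr_gt0; lra.
by move=> h1 h2; field; apply/andP; split; exact: lt0r_neq0.
Qed.

End SqDist.

Section Proposition.
Variables (R : realType) (n m : nat) (U : set 'rV[R]_n).
Hypothesis oU : open U.
Local Notation V := 'rV[R]_n.
Local Notation FF := {ffun 'I_n -> 'I_m.+1}.
Variable K : set V.
Hypotheses (KU : K `<=` U) (cK : compact K).

Lemma smooth_symbol_symb_sub (cs : FF -> V -> R) (z : R) :
  (forall b, (mdeg b <= m)%N -> smooth_on U (cs b)) ->
  smooth_symbol U K (fun _ x xi => symb cs x xi - z) (fun _ _ xi => japan xi ^+ m).
Proof.
move=> sm.
have Sc : smooth_symbol U K (fun _ => cstF (- z)) (fun _ _ xi => japan xi ^+ m).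
  apply: (smooth_symbol_weight (c := 1)) ler01 _ (smooth_symbol_cst U K (c := fun _ => - z) _).
    by move=> a x xi _ _ _; rewrite mul1r exprn_ege1 // japan_ge1.
  by move=> a _ _; rewrite normrN.
have Sp := smooth_symbol_poly oU KU cK sm (fun b h => h).
by apply: smooth_symbol_ext (smooth_symbolD oU KU Sp Sc).
Qed.

Lemma lower_order_bound (cs : FF -> V -> R) :
  (forall b, (mdeg b <= m)%N -> smooth_on U (cs b)) ->
  exists2 B : R, 0 <= B & forall x xi, K x ->
    `|\sum_(b | (mdeg b < m)%N) cs b x * monom xi b| <= B * japan xi ^+ m.-1.
Proof.
move=> sm.
have dg (b : FF) : (mdeg b < m)%N -> (mdeg b <= m.-1)%N.
  by move=> h; rewrite -ltnS prednK // (leq_ltn_trans (leq0n _) h).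
have [B B0 H] := smooth_symbol_le
  (smooth_symbol_poly oU KU cK (P := fun b => (mdeg b < m)%N) (fun b h => sm b (ltnW h)) dg).
by exists B => // x xi Kx; exact: (H 1 x xi ltr01 (lexx _) Kx).
Qed.

Variables (ar ai : FF -> V -> R) (zr zi : R).
Hypothesis smooth_coef :
  forall b, (mdeg b <= m)%N -> smooth_on U (ar b) /\ smooth_on U (ai b).
Local Notation s := (sq_dist ar ai zr zi).
Local Notation L := (Lam ar ai zr zi).

Lemma japan_exp_le_sq_dist :
  (exists2 C : R, 0 < C & forall x xi, K x ->
     enorm xi ^+ m / C <= Num.sqrt (princ ar x xi ^+ 2 + princ ai x xi ^+ 2)) ->
  exists2 E : R, 0 <= E & forall x xi, K x -> japan xi ^+ m <= E * Num.sqrt (1 + s x xi).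
Proof.
move=> [C0 C00 ellip].
have [m0|m0] := posnP m.
  exists 1 => // x xi _; rewrite [in japan xi ^+ m]m0 expr0 mul1r -{1}sqrtr1.
  rewrite ler_sqrt ?lerDl ?sq_dist_ge0 //.
  by rewrite addr_ge0 ?sq_dist_ge0.
have [Br Br0 HBr] := lower_order_bound (fun b h => (smooth_coef h).1).
have [Bi Bi0 HBi] := lower_order_bound (fun b h => (smooth_coef h).2).
have [E E0 HE] := elliptic_absorb m.-1 C00 (addr_ge0 Br0 Bi0)
  (addr_ge0 (normr_ge0 zr) (normr_ge0 zi)).
exists (3 * E) => [|x xi Kx]; first by rewrite mulr_ge0.
have s0 := sq_dist_ge0 ar ai zr zi x xi.
have r0 : 0 <= Num.sqrt (s x xi) by exact: sqrtr_ge0.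
have r1 : 1 + 2 * Num.sqrt (s x xi) <= 3 * Num.sqrt (1 + s x xi).
  have : 1 <= Num.sqrt (1 + s x xi) by rewrite -{1}sqrtr1 ler_sqrt; lra.
  have : Num.sqrt (s x xi) <= Num.sqrt (1 + s x xi) by rewrite ler_sqrt; lra.
  lra.
have Jk0 : 0 <= japan xi ^+ m.-1 by rewrite exprn_ge0 // ltW // japan_gt0.
have := HE (japan xi) (enorm xi) (2 * Num.sqrt (s x xi)); rewrite prednK // => {}HE.
rewrite [3 * E]mulrC -mulrA; apply: (le_trans _ (ler_wpM2l E0 r1)).
apply: HE; [exact: japan_ge1 | exact: japan_le1D | exact: sqrtr_ge0 | lra |].
rewrite -ler_pdivrMl // mulrC.
apply: le_trans (ellip x xi Kx) _; apply: le_trans (sqrt_sqrD_le _ _) _.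
have hr := HBr x xi Kx; have hi := HBi x xi Kx.
have qr := norm_re_le_sq_dist ar ai zr zi x xi.
have qi := norm_im_le_sq_dist ar ai zr zi x xi.
rewrite symb_split in qr; rewrite symb_split in qi.
set lr := \sum_(b | _) ar b x * _ in hr qr; set li := \sum_(b | _) ai b x * _ in hi qi.
set P := princ ar x xi in qr *; set Q := princ ai x xi in qi *.
have norm_split (p l z : R) : `|p| <= `|p + l - z| + `|l| + `|z|.
  rewrite {1}(_ : p = p + l - z - l + z); last by ring.
  by apply: le_trans (ler_normD _ _) _; rewrite lerD2r ler_normB.
have := norm_split P lr zr; have := norm_split Q li zi.
have : (Br + Bi) * japan xi ^+ m.-1 = Br * japan xi ^+ m.-1 + Bi * japan xi ^+ m.-1 by ring.
lra.
Qed.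

Lemma rhoL_std_ge0 o a x xi : 0 <= rhoL (@rho_std R n) L o a x xi.
Proof. by rewrite /rhoL mulr_ge0 ?rho_std_ge0 // invr_ge0 sqrtr_ge0. Qed.

Lemma sq_dist_derivable N : derivable_upto U N s.
Proof.
have [dr _] := smooth_symbol_symb_sub zr (fun b h => (smooth_coef h).1).
have [di _] := smooth_symbol_symb_sub zi (fun b h => (smooth_coef h).2).
exact (fderivable_uptoD oU (fderivable_uptoM oU (dr N) (dr N))
  (fderivable_uptoM oU (di N) (di N)) ltr01).
Qed.

(* [|p - z| <= sqrt s <= sqrt (a + s)] and, by ellipticity, [<xi>^m <~ sqrt (a + s) / Lam],
   so [p - z] has the weight [sqrt (a + s)] if each derivative costs [1/Lam]. *)
Lemma symb_sub_bounded N (cs : FF -> V -> R) z (E : R) :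
  (forall b, (mdeg b <= m)%N -> smooth_on U (cs b)) -> 0 <= E ->
  (forall x xi, `|symb cs x xi - z| <= Num.sqrt (s x xi)) ->
  (forall x xi, K x -> japan xi ^+ m <= E * Num.sqrt (1 + s x xi)) ->
  bounded_upto K (rhoL (@rho_std R n) L) N
    (fun _ x xi => symb cs x xi - z) (fun a x xi => Num.sqrt (a + s x xi)).
Proof.
move=> sm E0 hq hE; have [_ B] := smooth_symbol_symb_sub z sm.
apply: (bounded_upto_trade (@rho_std_ge0 R n) (fun a x xi a0 _ _ => Lam_gt0 _ _ _ _ x xi a0)
  (fun a x xi _ a1 _ => Lam_le1 _ _ _ _ x xi a1) E0) (B N) => a x xi a0 a1 Kx.
  have s0 := sq_dist_ge0 ar ai zr zi x xi.
  by apply: le_trans (hq x xi) _; rewrite ler_sqrt; lra.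
by rewrite -mulrA sqrt_sq_distD_divLam //; exact: hE.
Qed.

Lemma sq_dist_bounded :
  (exists2 C : R, 0 < C & forall x xi, K x ->
     enorm xi ^+ m / C <= Num.sqrt (princ ar x xi ^+ 2 + princ ai x xi ^+ 2)) ->
  forall N, bounded_upto K (rhoL (@rho_std R n) L) N (fun _ => s) (fun a x xi => a + s x xi).
Proof.
move=> ellip N; have [E E0 HE] := japan_exp_le_sq_dist ellip.
have smr b h := (@smooth_coef b h).1; have smi b h := (@smooth_coef b h).2.
have [dr _] := smooth_symbol_symb_sub zr smr; have [di _] := smooth_symbol_symb_sub zi smi.
have Br := symb_sub_bounded (N := N) smr E0 (norm_re_le_sq_dist ar ai zr zi) HE.
have Bi := symb_sub_bounded (N := N) smi E0 (norm_im_le_sq_dist ar ai zr zi) HE.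
have B := bounded_uptoD oU KU
  (fderivable_uptoM oU (dr N) (dr N)) (fderivable_uptoM oU (di N) (di N))
  (bounded_uptoM oU KU rhoL_std_ge0 (dr N) (dr N) Br Br)
  (bounded_uptoM oU KU rhoL_std_ge0 (di N) (di N) Bi Bi).
refine (bounded_upto_weight rhoL_std_ge0 (c := 1) ler01 _ B) => a x xi a0 _ _.
have s0 := sq_dist_ge0 ar ai zr zi x xi.
by rewrite /mul_fam /mulF mul1r -expr2 sqr_sqrtr //; lra.
Qed.

End Proposition.

Theorem proposition4p1 (R : realType) (n m : nat) (U : set 'rV[R]_n)
  (ar ai : {ffun 'I_n -> 'I_m.+1} -> 'rV[R]_n -> R) :
  open U ->
  (forall a, (mdeg a <= m)%N -> smooth_on U (ar a) /\ smooth_on U (ai a)) ->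
  (forall K : set 'rV[R]_n, compact K -> K `<=` U ->
     exists2 C : R, 0 < C & forall x xi, K x ->
       enorm xi ^+ m / C <= Num.sqrt (princ ar x xi ^+ 2 + princ ai x xi ^+ 2)) ->
  forall zr zi : R, exists2 alpha0 : R, 0 < alpha0 &
  forall (l : R) (ta b : 'I_n -> nat) (K : set 'rV[R]_n), compact K -> K `<=` U ->
  exists C : R, forall (alpha : R) (x xi : 'rV[R]_n),
    0 < alpha -> alpha <= alpha0 -> K x ->
    `| dX ta (dXi b (fun y eta => (1 + sq_dist ar ai zr zi y eta / alpha) `^ l)) x xi |
      <= C * (1 + sq_dist ar ai zr zi x xi / alpha) `^ l
           * Lam ar ai zr zi alpha x xi ^- (mlen ta + mlen b)
           * japan xi ^- mlen b.
Proof.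
move=> oU smooth ellip zr zi; exists 1 => // l ta b K cK KU.
pose ds := ops true ta ++ ops false b.
have [C _ HC] := bounded_relpow oU KU (rhoL_std_ge0 ar ai zr zi)
  (fun x xi _ => sq_dist_ge0 ar ai zr zi x xi) (sq_dist_derivable oU KU cK zr zi smooth)
  (sq_dist_bounded oU KU cK zr zi smooth (ellip K cK KU)) l (leqnn (size ds)).
exists C => alpha x xi a0 a1 Kx; rewrite dX_dXi_pderivs.
apply: le_trans (HC alpha x xi a0 a1 Kx) _.
rewrite rhos_rhoL /rhos big_cat -!/(rhos _ _ _ _ _) !rhos_std_ops size_cat !size_ops.
by rewrite /= expr0 invr1 mul1r mulrA.
Qed.
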